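(* Let $h,h':A\to[0,\infty)$ with $h\sim h'$ and let $\varphi(t)=(1+t)^p$, $p>0$. Then there are $M_1,M_2>0$ with $$M_1\,\|f\|_{\infty,h;\varphi;L}\ \le\ \|f\|_{\infty,h';\varphi;L}\ \le\ M_2\,\|f\|_{\infty,h;\varphi;L}$$ for all $f\in C(A)$ and $L\in\mathbb{R}$, and likewise for the sharp norms: $M_1\|[f]\|^{\sharp}_{\infty,h;\varphi}\le\|[f]\|^{\sharp}_{\infty,h';\varphi}\le M_2\|[f]\|^{\sharp}_{\infty,h;\varphi}$ for all $f\in C(A)$.
   Context: $A$ is a non-compact, locally compact, $\sigma$-compact Hausdorff space and $C(A)$ is the space of real continuous functions on $A$. Two functions $h,h':A\to[0,\infty)$ are coarsely affinely equivalent, written $h\sim h'$, if there are $a_1,a_2>0$ and $b_1,b_2\ge0$ with $a_1h-b_1\le h'\le a_2h+b_2$ on $A$. $\|f\|_{\infty,h;\varphi;L}:=\sup_{a\in A}\varphi(h(a))|f(a)-L|\in[0,\infty]$ and $\|[f]\|^{\sharp}_{\infty,h;\varphi}:=\inf_{c\in\mathbb{R}}\|f\|_{\infty,h;\varphi;c}\in[0,\infty]$, where $[f]$ is the class of $f$ in $C(A)/\mathbb{R}$ (modulo constants). *)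

(* Defs.v *)
From HB Require Import structures.
From mathcomp Require Import all_boot all_order all_algebra generic_quotient.
From mathcomp Require Import all_classical all_reals all_analysis.

Set Implicit Arguments.
Unset Strict Implicit.
Unset Printing Implicit Defensive.

Import Order.TTheory GRing.Theory Num.Theory.
Import numFieldNormedType.Exports.

Local Open Scope classical_set_scope.
Local Open Scope ring_scope.

Definition sigma_compact (T : topologicalType) (A : set T) : Prop :=
  exists2 K : nat -> set T, (forall n, compact (K n)) & \bigcup_n K n = A.

Definition coarse_affine_equiv (R : realType) (T : Type) (h h' : T -> R) : Prop :=
  exists a1 a2 b1 b2 : R,
    [/\ 0 < a1, 0 < a2, 0 <= b1, 0 <= b2 &
        forall x, a1 * h x - b1 <= h' x <= a2 * h x + b2].

Definition wnorm (R : realType) (T : Type) (h : T -> R) (phi : R -> R)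
    (f : T -> R) (L : R) : \bar R :=
  ereal_sup (range (fun x => (phi (h x) * `|f x - L|)%:E)).

Section ModuloConstants.
Context (R : realType) (T : topologicalType).
Local Notation CT := (continuousType T R).

Definition eq_mod_const : rel CT :=
  fun f g => `[< exists c : R, forall x, f x = g x + c >].

Let eq_mod_const_refl : reflexive eq_mod_const.
Proof. by move=> f; apply/asboolP; exists 0 => x; rewrite addr0. Qed.

Let eq_mod_const_sym : symmetric eq_mod_const.
Proof.
by move=> f g; apply/asboolP/asboolP => -[c fg]; exists (- c) => x;
  rewrite fg addrK.
Qed.

Let eq_mod_const_trans : transitive eq_mod_const.
Proof.
move=> g f k /asboolP[c fg] /asboolP[d gk]; apply/asboolP; exists (d + c) => x.
by rewrite fg gk addrA.
Qed.

Canonical eq_mod_const_equiv :=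
  EquivRel eq_mod_const eq_mod_const_refl eq_mod_const_sym eq_mod_const_trans.

Local Open Scope quotient_scope.

Definition continuous_mod_const : Type := {eq_quot eq_mod_const}.
HB.instance Definition _ := Choice.on continuous_mod_const.
HB.instance Definition _ := EqQuotient.on continuous_mod_const.

Definition class_mod_const (f : CT) : continuous_mod_const :=
  \pi_continuous_mod_const f.

(* Defined through a chosen representative; by [sharp_normE] any
   representative of the class gives the same value. *)
Definition sharp_norm (h : T -> R) (phi : R -> R) (F : continuous_mod_const)
    : \bar R :=
  ereal_inf (range (fun c : R => wnorm h phi (repr F) c)).

Lemma sharp_normE (h : T -> R) (phi : R -> R) (f : CT) :
  sharp_norm h phi (class_mod_const f) =
  ereal_inf (range (fun c : R => wnorm h phi f c)).
Proof.
rewrite /sharp_norm; set g := repr _.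
have : g == f %[mod continuous_mod_const] by apply/eqP; exact: reprK.
rewrite eqmodE => /asboolP[d gf].
have wE c : wnorm h phi g (c + d) = wnorm h phi f c.
  by rewrite /wnorm; congr ereal_sup; apply: eq_imagel => x _;
    rewrite gf opprD addrACA subrr addr0.
congr ereal_inf; apply/seteqP; split => _ [c _ <-] /=.
  by exists (c - d) => //; rewrite -wE subrK.
by exists (c + d).
Qed.

End ModuloConstants.

(* Main.v *)
(** Since both weights are at least [0], [h' <= a h + b] gives
    [1 + h' <= (1 + a + b) (1 + h)], and the powers compare with constant
    [(1 + a + b) `^ p]. A pointwise comparison of weights passes to the suprema
    and then to the infima over constants; exchanging the roles of [h] and [h']
    gives the reverse bounds. *)
Require Import Defs.
From mathcomp Require Import all_boot all_order all_algebra.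
From mathcomp Require Import all_classical all_reals all_analysis.
From mathcomp Require Import lra.
Import Order.TTheory GRing.Theory Num.Theory.
Import numFieldNormedType.Exports.
Local Open Scope classical_set_scope.
Local Open Scope ring_scope.

Lemma wnorm_le_scale (R : realType) (T : Type) (h h' : T -> R) (phi : R -> R)
    (K : R) (f : T -> R) (L : R) :
  0 < K -> (forall x, phi (h' x) <= K * phi (h x)) ->
  (wnorm h' phi f L <= K%:E * wnorm h phi f L)%E.
Proof.
move=> K_gt0 le_phi; apply: ge_ereal_sup => _ [x _ <-].
apply: (@le_trans _ _ (K%:E * (phi (h x) * `|f x - L|)%:E)%E).
  by rewrite -EFinM lee_fin mulrA ler_wpM2r.
(* As [K] is finite and positive, it cancels even when the supremum is [+oo]. *)
by rewrite lee_pmul2l ?fin_numE// ?lte_fin//; apply: ereal_sup_ubound; exists x.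
Qed.

Lemma sharp_norm_le_scale (R : realType) (T : topologicalType) (h h' : T -> R)
    (phi : R -> R) (K : R) (F : continuous_mod_const R T) :
  0 < K -> (forall x, phi (h' x) <= K * phi (h x)) ->
  (sharp_norm h' phi F <= K%:E * sharp_norm h phi F)%E.
Proof.
(* Moving [K] to the left leaves a bare infimum on the right, so each [c] can be treated separately;
   the same [c] then serves as competitor for [h'], both norms using [repr F]. *)
move=> K_gt0 le_phi; rewrite -lee_pdivrMl//; apply: le_ereal_inf_tmp => _ [c _ <-].
rewrite lee_pdivrMl//; apply: ge_ereal_inf; exists (wnorm h' phi (repr F) c).
  by exists c.
exact: wnorm_le_scale.
Qed.

Lemma powR_affine_le (R : realType) (a b p x y : R) :
  0 <= a -> 0 <= b -> 0 <= p -> 0 <= x -> 0 <= y -> y <= a * x + b ->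
  (1 + y) `^ p <= (1 + a + b) `^ p * (1 + x) `^ p.
Proof.
move=> a_ge0 b_ge0 p_ge0 x_ge0 y_ge0 le_y.
rewrite -powRM ?addr_ge0//; apply: ge0_ler_powR; rewrite ?nnegrE ?mulr_ge0 ?addr_ge0//.
(* The product exceeds [1 + a * x + b] by [x + a + b * x]; the sign of the nonlinear term must be
   supplied to [lra]. *)
have bx_ge0 : 0 <= b * x by rewrite mulr_ge0.
by lra.
Qed.

Theorem lemma2p11 (R : realType) (A : topologicalType)
    (A_noncompact : ~ compact [set: A])
    (A_lcompact : locally_compact [set: A])
    (A_scompact : sigma_compact [set: A])
    (A_hausdorff : hausdorff_space A)
    (h h' : A -> R) (h_ge0 : forall a, 0 <= h a) (h'_ge0 : forall a, 0 <= h' a)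
    (hh' : coarse_affine_equiv h h')
    (p : R) (p_gt0 : 0 < p) :
  let phi := fun t : R => (1 + t) `^ p in
  exists M1 M2 : R,
    [/\ 0 < M1, 0 < M2,
        forall (f : continuousType A R) (L : R),
          (M1%:E * wnorm h phi f L <= wnorm h' phi f L
             <= M2%:E * wnorm h phi f L)%E &
        forall f : continuousType A R,
          (M1%:E * sharp_norm h phi (class_mod_const f)
             <= sharp_norm h' phi (class_mod_const f)
             <= M2%:E * sharp_norm h phi (class_mod_const f))%E].
Proof.
move=> phi; have [a1 [a2 [b1 [b2 [a1_gt0 a2_gt0 b1_ge0 b2_ge0 hb]]]]] := hh'.
(* Solving [a1 * h - b1 <= h'] for [h] gives slope [a1^-1] and intercept [a1^-1 * b1], whence
   [K1]. *)
pose K1 := (1 + a1^-1 + a1^-1 * b1) `^ p; pose K2 := (1 + a2 + b2) `^ p.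
have a1V_ge0 : 0 <= a1^-1 by rewrite invr_ge0 ltW.
have K1_gt0 : 0 < K1 by rewrite powR_gt0// -addrA ltr_pwDl// addr_ge0// mulr_ge0.
have K2_gt0 : 0 < K2 by rewrite powR_gt0// -addrA ltr_pwDl// addr_ge0// ltW.
have le1 a : phi (h a) <= K1 * phi (h' a).
  apply: powR_affine_le; rewrite ?mulr_ge0 ?(ltW p_gt0)//.
  by have /andP[+ _] := hb a; rewrite -mulrDr ler_pdivlMl// lerBlDr.
have le2 a : phi (h' a) <= K2 * phi (h a).
  by have /andP[_] := hb a; apply: powR_affine_le => //; exact: ltW.
(* [K1] bounds the [h] norms by the [h'] norms, so its inverse is the lower constant. *)
exists K1^-1, K2; split=> [||f L|f]; rewrite ?invr_gt0//; apply/andP; split.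
- by rewrite lee_pdivrMl//; exact: wnorm_le_scale.
- exact: wnorm_le_scale.
- by rewrite lee_pdivrMl//; exact: sharp_norm_le_scale.
- exact: sharp_norm_le_scale.
Qed.
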